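(* Let $\phi$ be a linear fractional map with $\phi(\mathbb{D})\subset\mathbb{D}$, not the identity, which has a fixed point $p\in\mathbb{D}$. Then for every $\nu\in\mathbb{R}$, the composition operator $C_\phi$ is recurrent on $\mathcal{S}_\nu$ if and only if $\phi$ is an elliptic automorphism of $\mathbb{D}$.
   Context: $\mathbb{D}$ is the open unit disk of $\mathbb{C}$. For $\nu\in\mathbb{R}$, the weighted Dirichlet space $\mathcal{S}_\nu$ is the Hilbert space of analytic functions $f(z)=\sum_{n\ge 0}a_nz^n$ on $\mathbb{D}$ with $\|f\|_\nu^2=\sum_{n\ge0}|a_n|^2(n+1)^{2\nu}<\infty$. For a self-map $\phi$ of $\mathbb{D}$, $C_\phi f=f\circ\phi$; it is known that $C_\phi$ is bounded on every $\mathcal{S}_\nu$ when $\phi$ is a linear fractional self-map of $\mathbb{D}$. A bounded linear operator $T$ on a Hilbert space $\mathcal{H}$ is recurrent if for every non-empty open $U\subset\mathcal{H}$ there is a positive integer $n$ with $T^n(U)\cap U\neq\emptyset$. A linear fractional map is $\phi(z)=\frac{az+b}{cz+d}$ with $ad-bc\ne0$. If $\phi$ is not the identity and has two distinct fixed points in $\hat{\mathbb{C}}=\mathbb{C}\cup\{\infty\}$, it is conjugate (by a linear fractional map) to a dilation $z\mapsto\mu z$; it is called elliptic if $|\mu|=1$. An elliptic self-map of $\mathbb{D}$ is always an automorphism of $\mathbb{D}$ with one fixed point in $\mathbb{D}$. *)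

(* Defs.v *)
From Stdlib Require Import Reals ClassicalEpsilon.
From Coquelicot Require Export Coquelicot.
Open Scope R_scope.

Definition disk : Type := {z : C | Cmod z < 1}.

Definition disk_val (z : disk) : C := proj1_sig z.
Coercion disk_val : disk >-> C.

(* The Riemann sphere; [None] is the point at infinity. *)
Definition Chat : Type := option C.

Definition mobius (a b c d : C) (x : Chat) : Chat :=
  match x with
  | Some z =>
      if Ceq_dec (c * z + d)%C 0 then None
      else Some ((a * z + b) / (c * z + d))%C
  | None => if Ceq_dec c 0 then None else Some (a / c)%C
  end.

Definition linear_fractional (phi : Chat -> Chat) : Prop :=
  exists a b c d : C,
    (a * d - b * c)%C <> 0%C /\ forall x, phi x = mobius a b c d x.

Definition is_identity (phi : Chat -> Chat) : Prop := forall x, phi x = x.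

Definition dilation (mu : C) (x : Chat) : Chat :=
  match x with
  | Some z => Some (mu * z)%C
  | None => None
  end.

(* psi o phi o psi^-1 = dilation mu, written without the inverse of psi. *)
Definition conjugate_to_dilation (phi : Chat -> Chat) (mu : C) : Prop :=
  exists psi : Chat -> Chat,
    linear_fractional psi /\ forall x, psi (phi x) = dilation mu (psi x).

Definition elliptic (phi : Chat -> Chat) : Prop :=
  linear_fractional phi /\ ~ is_identity phi /\
  (exists x y : Chat, x <> y /\ phi x = x /\ phi y = y) /\
  exists mu : C, Cmod mu = 1 /\ conjugate_to_dilation phi mu.

Definition maps_disk (phi : Chat -> Chat) : Prop :=
  forall z : disk, exists w : disk, phi (Some (z : C)) = Some (w : C).

(* Analyticity of phi and of its inverse is automatic: this is only applied to
   linear fractional maps. *)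
Definition disk_automorphism (phi : Chat -> Chat) : Prop :=
  maps_disk phi /\
  forall w : disk, exists! z : disk, phi (Some (z : C)) = Some (w : C).

Definition disk_map (phi : Chat -> Chat) (h : maps_disk phi) (z : disk) : disk :=
  proj1_sig (constructive_indefinite_description _ (h z)).

Lemma disk_map_spec (phi : Chat -> Chat) (h : maps_disk phi) (z : disk) :
  phi (Some (z : C)) = Some (disk_map phi h z : C).
Proof. exact (proj2_sig (constructive_indefinite_description _ (h z))). Qed.

Definition is_power_series (a : nat -> C) (f : disk -> C) : Prop :=
  forall z : disk,
    is_pseries (K := C_AbsRing) (V := C_NormedModule) a (z : C) (f z).

(* f belongs to S_nu and its norm is r. *)
Definition has_norm (nu : R) (f : disk -> C) (r : R) : Prop :=
  0 <= r /\
  exists a : nat -> C,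
    is_power_series a f /\
    is_series (fun n : nat => Cmod (a n) ^ 2 * Rpower (INR n + 1) (2 * nu))
      (r ^ 2).

Definition in_S (nu : R) (f : disk -> C) : Prop := exists r, has_norm nu f r.

Definition open_in_S (nu : R) (U : (disk -> C) -> Prop) : Prop :=
  (forall f, U f -> in_S nu f) /\
  forall f, U f ->
    exists eps, 0 < eps /\
      forall g r, in_S nu g ->
        has_norm nu (fun z => (g z - f z)%C) r -> r < eps -> U g.

Definition recurrent (nu : R) (T : (disk -> C) -> (disk -> C)) : Prop :=
  forall U : (disk -> C) -> Prop,
    open_in_S nu U -> (exists f, U f) ->
    exists n : nat, (0 < n)%nat /\ exists f, U f /\ U (Nat.iter n T f).

Definition comp_op (phi : disk -> disk) (f : disk -> C) : disk -> C :=
  fun z => f (phi z).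

(* Main.v *)
Require Import Defs.
From Stdlib Require Import Reals Lra Lia List.
From Coquelicot Require Import Coquelicot.
Open Scope R_scope.

(** For the "if" part, let [psi] conjugate [phi] to the rotation by [mu], [|mu| = 1].  Some powers
    [mu^n], [n > 0], are arbitrarily close to [1], and then [phi^n = (az+b)/(1+cz)] with
    [a] close to [1] and [b], [c] close to [0].  Hence [P o phi^n] is close to [P] for every
    polynomial [P], even in the stronger sense that the Taylor coefficients of the difference
    are at most [eps 2^-n]; since polynomials are dense in [S_nu], [C_phi] is recurrent.

    For the "only if" part, write [phi(z) - p = l(z-p)/(1+c(z-p))].  In the coordinate
    [u = (z-p)/(1-conj(p)z)] the map becomes [lu/(1+su)] with [s = conj(p)(1-l) + c(1-|p|^2)],
    and a map of this form preserving the disk satisfies [|l| + |s| <= 1].  If [|l| = 1] then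
    [s = 0] and [phi] is conjugate to a rotation by an automorphism of the disk.  If [|l| < 1]
    then [phi] contracts a neighbourhood of [p] towards [p]; the functions [f] with
    [f(z) - f(p)] uniformly close to [z - p], relative to [|z-p|], near [p] form an open set,
    and no [f o phi^n], [n > 0], can be in it together with [f]. *)

(** * Functions with geometrically decaying Taylor coefficients *)

Notation cseries := (@is_series C_AbsRing C_NormedModule).

Lemma pow_n_Cpow (z : C) (k : nat) : @pow_n C_Ring (z : C) k = (z ^ k)%C.
Proof.
  induction k as [|k IH]; [reflexivity|].
  change (z * @pow_n C_Ring (z : C) k = z ^ S k)%C. now rewrite IH, Cpow_S.
Qed.

Lemma is_power_series_iff (a : nat -> C) (f : disk -> C) :
  is_power_series a f <->
  forall z : disk, cseries (fun k => (z : C) ^ k * a k)%C (f z).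
Proof.
  split; intros H z; refine (is_series_ext _ _ _ _ (H z)); intro k;
    change (@pow_n C_Ring (z : C) k * a k = (z : C) ^ k * a k)%C;
    now rewrite pow_n_Cpow.
Qed.

Lemma cseries_unique (a : nat -> C) (l l' : C) :
  cseries a l -> cseries a l' -> l = l'.
Proof.
  exact (@filterlim_locally_unique nat C_AbsRing C_NormedModule eventually _ _ l l').
Qed.

Lemma cseries_bound (a : nat -> C) (b : nat -> R) (l : C) (B : R) :
  cseries a l -> is_series b B -> (forall n, Cmod (a n) <= b n) -> Cmod l <= B.
Proof.
  intros Ha Hb Hab.
  assert (H1 : is_lim_seq (fun n => Cmod (@sum_n C_AbelianMonoid a n)) (Cmod l)).
  { exact (filterlim_comp _ _ _ _ (@norm C_AbsRing C_NormedModule) _ _ _ Ha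
      (@filterlim_norm C_AbsRing C_NormedModule l)). }
  assert (H2 : is_lim_seq (sum_n b) B) by exact Hb.
  refine (is_lim_seq_le _ _ _ _ _ H1 H2). intro n.
  eapply Rle_trans; [exact (@norm_sum_n_m C_AbsRing C_NormedModule a 0 n)|].
  apply sum_n_m_le; intro k; exact (Hab k).
Qed.

Lemma ex_cseries_le (a : nat -> C) (b : nat -> R) :
  (forall n, Cmod (a n) <= b n) -> ex_series b -> exists l : C, cseries a l.
Proof. exact (@ex_series_le C_AbsRing C_CompleteNormedModule a b). Qed.

Lemma sum_n_truncate {G : AbelianMonoid} (a : nat -> G) (N n : nat) :
  (N <= n)%nat ->
  sum_n (fun k => if (k <=? N)%nat then a k else zero) n = sum_n a N.
Proof.
  intros H. induction H as [|n H IH].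
  - apply sum_n_ext_loc; intros k Hk.
    now apply Nat.leb_le in Hk as ->.
  - rewrite sum_Sn, IH. replace (S n <=? N)%nat with false.
    + apply plus_zero_r.
    + symmetry; apply Nat.leb_gt; lia.
Qed.

Lemma is_series_truncate {K : AbsRing} {V : NormedModule K} (a : nat -> V) (N : nat) :
  is_series (fun k => if (k <=? N)%nat then a k else zero) (sum_n a N).
Proof.
  apply filterlim_ext_loc with (f := fun _ => sum_n a N).
  - exists N; intros n Hn; symmetry; now apply sum_n_truncate.
  - apply filterlim_const.
Qed.

(* The norm of this Hardy-type space dominates every [S_nu] norm, and its elements can be
   multiplied by [z] and divided by [1 + cz] coefficientwise. *)
Definition dominated (M : R) (f : disk -> C) : Prop :=
  exists a : nat -> C,
    is_power_series a f /\ forall n, Cmod (a n) <= M * (/ 2) ^ n.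

Lemma dominated_ext (M : R) (f g : disk -> C) :
  (forall z, f z = g z) -> dominated M f -> dominated M g.
Proof.
  intros E (a & Ha & Hb). exists a; split; [|exact Hb].
  intro z; rewrite <- E; apply Ha.
Qed.

Lemma dominated_le (M N : R) (f : disk -> C) :
  M <= N -> dominated M f -> dominated N f.
Proof.
  intros E (a & Ha & Hb). exists a; split; [exact Ha|].
  intro n. eapply Rle_trans; [apply Hb|].
  apply Rmult_le_compat_r; [apply pow_le; lra|exact E].
Qed.

Lemma dominated_plus (M N : R) (f g : disk -> C) :
  dominated M f -> dominated N g -> dominated (M + N) (fun z => f z + g z)%C.
Proof.
  intros (a & Ha & Ma) (b & Hb & Mb).
  exists (fun n => a n + b n)%C; split.
  - intro z. exact (is_pseries_plus a b (z : C) _ _ (Ha z) (Hb z)).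
  - intro n. specialize (Ma n); specialize (Mb n).
    pose proof (Cmod_triangle (a n) (b n)); lra.
Qed.

Lemma dominated_scal (c : C) (M : R) (f : disk -> C) :
  dominated M f -> dominated (Cmod c * M) (fun z => c * f z)%C.
Proof.
  intros (a & Ha & Ma). rewrite is_power_series_iff in Ha.
  exists (fun n => c * a n)%C; split.
  - apply is_power_series_iff; intro z.
    eapply is_series_ext; [|exact (is_series_scal_l c _ _ (Ha z))].
    intro n. change (c * ((z : C) ^ n * a n) = (z : C) ^ n * (c * a n))%C. ring.
  - intro n. rewrite Cmod_mult, Rmult_assoc.
    apply Rmult_le_compat_l; [apply Cmod_ge_0|apply Ma].
Qed.

Lemma cseries_shift (a : nat -> C) (l : C) :
  cseries (fun n => a (S n)) l -> cseries a (l + a 0%nat)%C.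
Proof.
  intro H. apply is_series_decr_1.
  change (cseries (fun k => a (S k)) (l + a 0%nat + - a 0%nat)%C).
  now replace (l + a 0%nat + - a 0%nat)%C with l by ring.
Qed.

(** Shifting the coefficients by one place costs one factor [/ 2] of the decay, hence the
    doubling. *)
Lemma dominated_mul_z (M : R) (f : disk -> C) :
  0 <= M -> dominated M f -> dominated (2 * M) (fun z => z * f z)%C.
Proof.
  intros M0 (a & Ha & Ma). rewrite is_power_series_iff in Ha.
  exists (fun n => match n with 0%nat => RtoC 0 | S k => a k end); split.
  - apply is_power_series_iff; intro z.
    replace (z * f z)%C with (z * f z + (z : C) ^ 0 * 0)%C by ring.
    apply (cseries_shift (fun n => (z : C) ^ n * match n with 0%nat => RtoC 0 | S k => a k end)%C).
    eapply is_series_ext; [|exact (is_series_scal_l (z : C) _ _ (Ha z))].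
    intro n. rewrite Cpow_S. change ((z : C) * ((z : C) ^ n * a n) = (z * (z : C) ^ n) * a n)%C. ring.
  - intros [|n].
    + rewrite Cmod_0; simpl; lra.
    + eapply Rle_trans; [apply Ma|]. simpl. lra.
Qed.

Lemma disk_lt (z : disk) : Cmod z < 1.
Proof. exact (proj2_sig z). Qed.

Lemma is_series_half (M : R) : ex_series (fun n => M * (/ 2) ^ n).
Proof.
  apply (@ex_series_scal_l R_AbsRing R_NormedModule M (fun n => (/ 2) ^ n)).
  apply ex_series_geom. rewrite Rabs_pos_eq; lra.
Qed.

Lemma Cpow_le_1 (z : C) (n : nat) : Cmod z <= 1 -> Cmod (z ^ n) <= 1.
Proof.
  intro H. rewrite Cmod_pow. rewrite <- (pow1 n).
  apply pow_incr; split; [apply Cmod_ge_0|exact H].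
Qed.

(** Comparing coefficients in [(1 + c z) * g(z) = f(z)] gives [b (S n) + c * b n = a (S n)], solved
    here for [b]. *)
Fixpoint div_coef (a : nat -> C) (c : C) (n : nat) : C :=
  match n with
  | 0%nat => a 0%nat
  | S k => (a (S k) - c * div_coef a c k)%C
  end.

Lemma one_plus_neq_0 (c : C) (z : C) :
  Cmod c <= / 4 -> Cmod z < 1 -> (1 + c * z)%C <> 0%C.
Proof.
  intros Hc Hz E.
  assert (E' : (c * z)%C = (- (1))%C) by (replace (c * z)%C with (1 + c * z - 1)%C by ring; rewrite E; ring).
  apply (f_equal Cmod) in E'. rewrite Cmod_mult, Cmod_opp, Cmod_1 in E'.
  pose proof (Cmod_ge_0 c); pose proof (Cmod_ge_0 z). nra.
Qed.

(** The bound [2 M 2^-n] reproduces itself through the recursion: [M 2^-(n+1)] comes from [a] and,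
    as [|c| <= 1/4], at most [M 2^-(n+1)] from the previous coefficient. *)
Lemma dominated_div (M : R) (c : C) (f : disk -> C) :
  0 <= M -> Cmod c <= / 4 -> dominated M f ->
  dominated (2 * M) (fun z => f z / (1 + c * z))%C.
Proof.
  intros M0 Hc (a & Ha & Ma). rewrite is_power_series_iff in Ha.
  set (b := div_coef a c).
  assert (Mb : forall n, Cmod (b n) <= 2 * M * (/ 2) ^ n).
  { induction n as [|n IH].
    - change (b 0%nat) with (a 0%nat). specialize (Ma 0%nat). simpl in Ma |- *; lra.
    - unfold b; simpl div_coef; fold b.
      eapply Rle_trans; [apply Cmod_triangle|]. rewrite Cmod_opp, Cmod_mult.
      specialize (Ma (S n)). simpl in *. pose proof (Cmod_ge_0 (b n)).
      pose proof (Cmod_ge_0 c).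
      assert (Cmod c * Cmod (b n) <= / 4 * (2 * M * (/ 2) ^ n))
        by (apply Rmult_le_compat; auto).
      nra. }
  exists b; split; [|exact Mb].
  apply is_power_series_iff; intro z. pose proof (disk_lt z) as Hz.
  destruct (ex_cseries_le (fun n => (z : C) ^ n * b n)%C (fun n => 2 * M * (/ 2) ^ n)) as [l Hl].
  { intro n. rewrite Cmod_mult. pose proof (Cpow_le_1 z n (Rlt_le _ _ Hz)).
    specialize (Mb n). pose proof (Cmod_ge_0 (b n)). nra. }
  { apply is_series_half. }
  (* The sum [l] of the new series is identified by multiplying back: the tail of [b] plus [c z]
     times the whole series is the tail of [a], and the constant terms agree. *)
  assert (E : f z = (l * (1 + c * z))%C).
  { apply (cseries_unique _ _ _ (Ha z)).
    replace (l * (1 + c * z))%C with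
      ((l - b 0%nat) + (c * z) * l + (z : C) ^ 0 * a 0%nat)%C
      by (unfold b; simpl; ring).
    apply (cseries_shift (fun n => (z : C) ^ n * a n)%C).
    assert (H1 : cseries (fun n => (z : C) ^ (S n) * b (S n))%C (l - b 0%nat)%C).
    { apply (is_series_incr_1 (fun n => (z : C) ^ n * b n)%C).
      replace (plus _ _) with l; [exact Hl|].
      change (@eq C l (l - b 0%nat + 1 * b 0%nat)%C). ring. }
    generalize (is_series_plus _ _ _ _ H1 (is_series_scal_l (c * z)%C _ _ Hl)).
    apply is_series_ext; intro n.
    change ((z : C) ^ (S n) * b (S n) + (c * z) * ((z : C) ^ n * b n) = (z : C) ^ (S n) * a (S n))%C.
    unfold b at 1; simpl div_coef; fold b. rewrite !Cpow_S. ring. }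
  rewrite E. pose proof (one_plus_neq_0 c z Hc Hz).
  now replace (l * (1 + c * z) / (1 + c * z))%C with l by (field; assumption).
Qed.

Lemma dominated_one : dominated 1 (fun _ => 1%C).
Proof.
  exists (fun n => if (n <=? 0)%nat then 1%C else 0%C); split.
  - apply is_power_series_iff; intro z.
    pose proof (@is_series_truncate C_AbsRing C_NormedModule (fun _ => RtoC 1) 0) as H.
    rewrite sum_O in H. revert H; apply is_series_ext; intros [|n]; simpl.
    + change (@eq C (RtoC 1) (1 * 1)%C); ring.
    + change (@eq C (RtoC 0) (z * z ^ n * 0)%C); ring.
  - intros [|n]; simpl.
    + rewrite Cmod_1; lra.
    + rewrite Cmod_0. pose proof (pow_lt (/2) n); lra.
Qed.

Lemma dominated_pow (k : nat) : dominated (2 ^ k) (fun z => (z : C) ^ k)%C.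
Proof.
  induction k as [|k IH].
  - exact dominated_one.
  - apply (dominated_mul_z (2 ^ k)) in IH; [|apply pow_le; lra].
    exact IH.
Qed.

(** * Maps close to the identity *)

(** The map [(a z + b) / (1 + c z)], with coefficients within [eta] of those of the identity; for
    [eta <= 1/4] the denominator has no zero in the disk. *)
Definition near_id (eta : R) (w : disk -> C) : Prop :=
  exists a b c : C,
    Cmod (a - 1) <= eta /\ Cmod b <= eta /\ Cmod c <= eta /\
    forall z : disk, (w z * (1 + c * z) = a * z + b)%C.

(** Here [w - z = ((a - 1) z + b - c z^2) / (1 + c z)], whose numerator has all coefficients of size
    [eta]. Each factor [z] and the division double the bound: [2 (2 + 1 + 4) = 14]. For [w] itself
    [|a| <= 2] and [|b| <= 1] give [2 (4 + 1) = 10]. *)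
Lemma near_id_mul (eta M : R) (w h : disk -> C) :
  eta <= / 4 -> near_id eta w -> 0 <= M -> dominated M h ->
  dominated (10 * M) (fun z => w z * h z)%C /\
  dominated (eta * (14 * M)) (fun z => (w z - z) * h z)%C.
Proof.
  intros He (a & b & c & Ha & Hb & Hc & Hw) M0 Hh.
  assert (Hc' : Cmod c <= / 4) by lra.
  pose proof (Cmod_ge_0 a). pose proof (Cmod_ge_0 b). pose proof (Cmod_ge_0 c).
  assert (Ha' : Cmod a <= 1 + eta).
  { replace a with (1 + (a - 1))%C by ring.
    eapply Rle_trans; [apply Cmod_triangle|]. rewrite Cmod_1; lra. }
  assert (Hz := dominated_mul_z _ _ M0 Hh).
  assert (M1 : 0 <= 2 * M) by lra.
  assert (Hzz := dominated_mul_z _ _ M1 Hz).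
  assert (D : forall z : disk, (1 + c * z)%C <> 0%C)
    by (intro z; apply one_plus_neq_0; [assumption|apply disk_lt]).
  assert (E : forall z : disk, w z = ((a * z + b) / (1 + c * z))%C)
    by (intro z; rewrite <- Hw; field; apply D).
  split.
  - assert (P := dominated_plus _ _ _ _ (dominated_scal a _ _ Hz) (dominated_scal b _ _ Hh)).
    apply (dominated_le _ (5 * M)) in P.
    2: { assert (Cmod a * M <= 2 * M) by (apply Rmult_le_compat_r; lra).
         assert (Cmod b * M <= 1 * M) by (apply Rmult_le_compat_r; lra). lra. }
    apply (dominated_div _ c) in P; [|lra|exact Hc'].
    refine (dominated_ext _ _ _ _ (dominated_le _ _ _ _ P)); [|lra].
    intro z; cbv beta. rewrite E. field. apply D.
  - assert (P := dominated_plus _ _ _ _ (dominated_plus _ _ _ _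
      (dominated_scal (a - 1) _ _ Hz) (dominated_scal b _ _ Hh)) (dominated_scal (- c) _ _ Hzz)).
    rewrite Cmod_opp in P.
    apply (dominated_le _ (eta * (7 * M))) in P.
    2: { pose proof (Rmult_le_compat_r M _ _ M0 Ha).
         pose proof (Rmult_le_compat_r M _ _ M0 Hb).
         pose proof (Rmult_le_compat_r M _ _ M0 Hc). lra. }
    apply (dominated_div _ c) in P; [|nra|exact Hc'].
    refine (dominated_ext _ _ _ _ (dominated_le _ _ _ _ P)); [|lra].
    intro z; cbv beta. rewrite E. field. apply D.
Qed.

(** Induction on [w^(k+1) - z^(k+1) = w (w^k - z^k) + (w - z) z^k]. It matters that [M] depends on
    neither [eta] nor [w]. *)
Lemma near_id_pow (k : nat) :
  exists M, 0 <= M /\ forall eta w, 0 <= eta <= / 4 -> near_id eta w ->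
    dominated (eta * M) (fun z => w z ^ k - (z : C) ^ k)%C.
Proof.
  induction k as [|k (M & M0 & IH)].
  - exists 1; split; [lra|]. intros eta w He Hw.
    refine (dominated_ext _ _ _ _ (dominated_le _ _ _ _ (dominated_scal 0 _ _ dominated_one))).
    + intro z; cbv beta; simpl; ring.
    + rewrite Cmod_0; lra.
  - assert (0 <= 2 ^ k) by (apply pow_le; lra).
    exists (10 * M + 14 * 2 ^ k); split; [lra|]. intros eta w He Hw.
    specialize (IH eta w He Hw).
    apply (near_id_mul eta _ w) in IH as [IH _]; [|lra|assumption|nra].
    destruct (near_id_mul eta _ w _ (proj2 He) Hw H (dominated_pow k)) as [_ P].
    refine (dominated_ext _ _ _ _ (dominated_le _ _ _ _ (dominated_plus _ _ _ _ IH P))); [|lra].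
    intro z; cbv beta. rewrite !Cpow_S. ring.
Qed.

Definition cpoly (a : nat -> C) (N : nat) (x : C) : C :=
  @sum_n C_AbelianMonoid (fun k => x ^ k * a k)%C N.

Lemma poly_O (a : nat -> C) (x : C) : cpoly a 0 x = a 0%nat.
Proof. unfold cpoly. rewrite sum_O. simpl. ring. Qed.

Lemma poly_S (a : nat -> C) (N : nat) (x : C) :
  cpoly a (S N) x = (cpoly a N x + a (S N) * x ^ S N)%C.
Proof.
  unfold cpoly. rewrite sum_Sn. change plus with Cplus. f_equal. apply Cmult_comm.
Qed.

Lemma poly_near_id (a : nat -> C) (N : nat) :
  exists M, 0 <= M /\ forall eta w, 0 <= eta <= / 4 -> near_id eta w ->
    dominated (eta * M) (fun z => cpoly a N (w z) - cpoly a N z)%C.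
Proof.
  induction N as [|N (M & M0 & IH)].
  - exists 1; split; [lra|]. intros eta w He Hw.
    refine (dominated_ext _ _ _ _ (dominated_le _ _ _ _ (dominated_scal 0 _ _ dominated_one))).
    + intro z; rewrite !poly_O; ring.
    + rewrite Cmod_0; lra.
  - destruct (near_id_pow (S N)) as (M' & M0' & H).
    pose proof (Cmod_ge_0 (a (S N))).
    exists (M + Cmod (a (S N)) * M'); split; [nra|]. intros eta w He Hw.
    refine (dominated_ext _ _ _ _ (dominated_le _ _ _ _ (dominated_plus _ _ _ _
      (IH eta w He Hw) (dominated_scal (a (S N)) _ _ (H eta w He Hw))))); [|lra].
    intro z; rewrite !poly_S; ring.
Qed.

Lemma poly_dominated (a : nat -> C) (N : nat) :
  exists M, 0 <= M /\ dominated M (fun z => cpoly a N z).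
Proof.
  induction N as [|N (M & M0 & IH)].
  - exists (Cmod (a 0%nat) * 1); split; [pose proof (Cmod_ge_0 (a 0%nat)); lra|].
    refine (dominated_ext _ _ _ _ (dominated_scal (a 0%nat) _ _ dominated_one)).
    intro z; rewrite poly_O; ring.
  - exists (M + Cmod (a (S N)) * 2 ^ S N); split.
    + pose proof (Cmod_ge_0 (a (S N))). assert (0 < 2 ^ S N) by (apply pow_lt; lra). nra.
    + refine (dominated_ext _ _ _ _ (dominated_plus _ _ _ _ IH
        (dominated_scal (a (S N)) _ _ (dominated_pow (S N))))).
      intro z; rewrite poly_S; ring.
Qed.

(** * The norm of [S_nu] and the density of polynomials *)

Lemma Rpower_pos (x y : R) : 0 < Rpower x y.
Proof. apply exp_pos. Qed.

Lemma INR_S_pos (n : nat) : 0 < INR n + 1.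
Proof. pose proof (pos_INR n); lra. Qed.

(** Ratio test: consecutive terms have ratio [rho (1 + 1/(n+1))^nu], which tends to [rho < 1]. *)
Lemma ex_series_Rpower_geom (nu rho : R) :
  0 < rho < 1 -> ex_series (fun n => Rpower (INR n + 1) nu * rho ^ n).
Proof.
  intro Hr.
  assert (Hp : forall n, 0 < Rpower (INR n + 1) nu * rho ^ n).
  { intro n; apply Rmult_lt_0_compat; [apply Rpower_pos|apply pow_lt; lra]. }
  apply ex_series_ext with (fun n => Rabs (Rpower (INR n + 1) nu * rho ^ n)).
  { intro n; apply Rabs_pos_eq; left; apply Hp. }
  apply ex_series_DAlembert with rho; [lra| |].
  { intro n; apply Rgt_not_eq, Hp. }
  apply is_lim_seq_ext with (fun n => rho * exp (nu * ln (1 + / (INR n + 1)))).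
  { intro n. rewrite Rabs_pos_eq
      by (left; apply Rdiv_lt_0_compat; apply Hp).
    pose proof (INR_S_pos n). rewrite S_INR.
    replace (1 + / (INR n + 1)) with ((INR n + 1 + 1) / (INR n + 1)) by (field; lra).
    rewrite ln_div by lra. unfold Rpower.
    rewrite Rmult_minus_distr_l. unfold Rminus. rewrite exp_plus, exp_Ropp.
    pose proof (exp_pos (nu * ln (INR n + 1))). pose proof (pow_lt rho n (proj1 Hr)).
    simpl. field; lra. }
  replace (Finite rho) with (Finite (rho * exp (nu * 0))) by (rewrite Rmult_0_r, exp_0; f_equal; ring).
  apply is_lim_seq_mult'; [apply is_lim_seq_const|].
  apply (is_lim_seq_continuous exp).
  { apply derivable_continuous_pt, derivable_pt_exp. }
  apply is_lim_seq_mult'; [apply is_lim_seq_const|].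
  (* Squeeze by [0 <= ln (1 + x) <= x] with [x = 1/(n+1)]. *)
  apply is_lim_seq_le_le with (fun _ => 0) (fun n => / (INR n + 1)).
  - intro n. assert (0 < / (INR n + 1)) by apply Rinv_0_lt_compat, INR_S_pos. split.
    + rewrite <- ln_1. left; apply ln_increasing; lra.
    + left.
      rewrite <- (ln_exp (/ (INR n + 1))) at 2.
      apply ln_increasing; [lra|]. apply exp_ineq1; lra.
  - apply is_lim_seq_const.
  - apply is_lim_seq_ext with (fun n => / INR (S n)).
    + intro n; now rewrite S_INR.
    + apply (is_lim_seq_incr_1 (fun n => / INR n)).
      replace (Finite 0) with (Rbar_inv p_infty) by reflexivity.
      apply is_lim_seq_inv; [apply is_lim_seq_INR|discriminate].
Qed.

Lemma sum_n_le_series (a : nat -> R) (l : R) :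
  (forall n, 0 <= a n) -> is_series a l -> forall n, sum_n a n <= l.
Proof.
  intros Ha Hl. apply is_lim_seq_incr_compare; [exact Hl|].
  intro n. rewrite sum_Sn. change plus with Rplus. specialize (Ha (S n)); lra.
Qed.

Lemma series_nonneg (a : nat -> R) (l : R) :
  (forall n, 0 <= a n) -> is_series a l -> 0 <= l.
Proof.
  intros Ha Hl. eapply Rle_trans; [exact (Ha 0%nat)|].
  rewrite <- (sum_O a). now apply sum_n_le_series.
Qed.

(** Since [|a_n|^2 <= M^2 4^-n], the squared norm is at most [M^2 S] with [S] the sum of
    [(n+1)^(2 nu) 4^-n]; so [K = sqrt S]. *)
Lemma has_norm_dominated (nu : R) :
  exists K, 0 < K /\ forall M f, 0 <= M -> dominated M f ->
    exists r, has_norm nu f r /\ r <= K * M.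
Proof.
  destruct (ex_series_Rpower_geom (2 * nu) (/ 4)) as [S HS]; [lra|].
  change R in (type of S).
  assert (S0 : 0 < S).
  { pose proof (Rpower_pos (INR 0 + 1) (2 * nu)). simpl in H.
    eapply Rlt_le_trans; [|refine (sum_n_le_series _ _ _ HS 0)].
    - rewrite sum_O. simpl. lra.
    - intro n; apply Rmult_le_pos; [left; apply Rpower_pos|apply pow_le; lra]. }
  exists (sqrt S); split; [now apply sqrt_lt_R0|].
  intros M f M0 (a & Ha & Ma).
  set (t := fun n => Cmod (a n) ^ 2 * Rpower (INR n + 1) (2 * nu)).
  assert (Ht : forall n, 0 <= t n <= M ^ 2 * (Rpower (INR n + 1) (2 * nu) * (/ 4) ^ n)).
  { intro n. pose proof (Rpower_pos (INR n + 1) (2 * nu)). pose proof (Cmod_ge_0 (a n)).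
    unfold t. split; [apply Rmult_le_pos; [apply pow2_ge_0|lra]|].
    replace (/ 4) with ((/ 2) ^ 2) by field. rewrite <- pow_mult, Nat.mul_comm, pow_mult.
    apply Rle_trans with ((M * (/ 2) ^ n) ^ 2 * Rpower (INR n + 1) (2 * nu)).
    - apply Rmult_le_compat_r; [lra|]. apply pow_incr; split; [lra|apply Ma].
    - right; ring. }
  assert (HM : is_series (fun n => M ^ 2 * (Rpower (INR n + 1) (2 * nu) * (/ 4) ^ n)) (M ^ 2 * S)).
  { exact (is_series_scal_l (M ^ 2) _ _ HS). }
  assert (Hs : is_series t (Series t)).
  { apply Series_correct.
    apply (@ex_series_le R_AbsRing R_CompleteNormedModule _
      (fun n => M ^ 2 * (Rpower (INR n + 1) (2 * nu) * (/ 4) ^ n))); [|now eexists; exact HM].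
    intro n. change (Rabs (t n) <= M ^ 2 * (Rpower (INR n + 1) (2 * nu) * (/ 4) ^ n)).
    rewrite Rabs_pos_eq; apply Ht. }
  assert (Hle : Series t <= M ^ 2 * S).
  { rewrite <- (is_series_unique _ _ HM). apply Series_le; [exact Ht|]. eexists; exact HM. }
  exists (sqrt (Series t)). split.
  - split; [apply sqrt_pos|]. exists a; split; [exact Ha|].
    rewrite pow2_sqrt; [exact Hs|]. apply (series_nonneg _ _ (fun n => proj1 (Ht n)) Hs).
  - apply Rsqr_incr_0_var; [|apply Rmult_le_pos; [apply sqrt_pos|lra]].
    rewrite Rsqr_mult, !Rsqr_sqrt; [|lra|].
    + unfold Rsqr; lra.
    + apply (series_nonneg _ _ (fun n => proj1 (Ht n)) Hs).
Qed.

(** Taylor polynomials suffice: the squared norm of the error is the tail [r^2 - sum_n t N] of a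
    convergent series. *)
Lemma poly_dense (nu : R) (f : disk -> C) (eps : R) :
  in_S nu f -> 0 < eps ->
  exists a N r, has_norm nu (fun z => cpoly a N z - f z)%C r /\ r < eps.
Proof.
  intros (r & r0 & a & Ha & Hr) He. rewrite is_power_series_iff in Ha.
  set (t := fun n => Cmod (a n) ^ 2 * Rpower (INR n + 1) (2 * nu)) in Hr.
  assert (He2 : 0 < eps ^ 2) by (apply pow_lt; lra).
  assert (Hl : is_lim_seq (sum_n t) (r ^ 2)) by exact Hr.
  apply is_lim_seq_spec in Hl. destruct (Hl (mkposreal _ He2)) as [N HN].
  specialize (HN N (le_n N)). simpl in HN.
  assert (Hd : is_series (fun n => Cmod ((if (n <=? N)%nat then a n else 0) - a n) ^ 2
      * Rpower (INR n + 1) (2 * nu)) (r ^ 2 - sum_n t N)).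
  { generalize (is_series_minus _ _ _ _ Hr (is_series_truncate t N)).
    apply is_series_ext; intro n.
    change (t n + - (if (n <=? N)%nat then t n else 0)
      = Cmod ((if (n <=? N)%nat then a n else 0) - a n) ^ 2 * Rpower (INR n + 1) (2 * nu)).
    unfold t; destruct (n <=? N)%nat.
    - replace (a n - a n)%C with (RtoC 0) by ring. rewrite Cmod_0. ring.
    - replace (0 - a n)%C with (- a n)%C by ring. rewrite Cmod_opp. ring. }
  exists a, N, (sqrt (r ^ 2 - sum_n t N)).
  assert (H0 : 0 <= r ^ 2 - sum_n t N).
  { refine (series_nonneg _ _ _ Hd). intro n.
    apply Rmult_le_pos; [apply pow2_ge_0|left; apply Rpower_pos]. }
  split.
  - split; [apply sqrt_pos|].
    exists (fun n => (if (n <=? N)%nat then a n else 0) - a n)%C; split.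
    + apply is_power_series_iff; intro z.
      generalize (is_series_minus _ _ _ _
        (@is_series_truncate C_AbsRing C_NormedModule (fun n => (z : C) ^ n * a n)%C N) (Ha z)).
      apply is_series_ext; intro n.
      destruct (n <=? N)%nat.
      * change (@eq C ((z : C) ^ n * a n - z ^ n * a n) (z ^ n * (a n - a n)))%C. ring.
      * change (@eq C (0 - z ^ n * a n) (z ^ n * (0 - a n)))%C. ring.
    + now rewrite pow2_sqrt.
  - rewrite <- (sqrt_pow2 eps) by lra. apply sqrt_lt_1; [exact H0|lra|].
    apply Rabs_lt_between in HN. lra.
Qed.

(** * Iterates of elliptic maps *)

Lemma pigeonhole (f : nat -> nat) (B : nat) :
  (forall i, (f i < B)%nat) -> exists i j, (i < j)%nat /\ f i = f j.
Proof.
  intro H. destruct (Classical_Prop.classic (exists i j, (i < j)%nat /\ f i = f j)) as [|N];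
    [assumption|exfalso].
  assert (D : NoDup (map f (seq 0 (S B)))).
  { apply NoDup_map_NoDup_ForallPairs; [|apply seq_NoDup].
    intros i j _ _ E. destruct (Nat.lt_trichotomy i j) as [L|[L|L]]; [|assumption|];
      exfalso; apply N; eauto. }
  assert (I : incl (map f (seq 0 (S B))) (seq 0 B)).
  { intros x Hx. apply in_map_iff in Hx as (i & <- & _). apply in_seq. specialize (H i); lia. }
  apply NoDup_incl_length in I; [|exact D].
  rewrite length_map, !length_seq in I. lia.
Qed.

Lemma Int_part_eq_dist (x y : R) : Int_part x = Int_part y -> Rabs (x - y) < 1.
Proof.
  intro E. pose proof (base_Int_part x) as Hx. pose proof (base_Int_part y) as Hy.
  rewrite E in Hx. apply Rabs_lt_between; lra.
Qed.

Lemma Int_part_bound (K : nat) (x : R) :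
  Rabs x <= INR K -> (0 <= Int_part x + Z.of_nat K <= 2 * Z.of_nat K)%Z.
Proof.
  intro H. apply Rabs_le_between in H. rewrite INR_IZR_INZ in H.
  pose proof (base_Int_part x) as Hx.
  assert (A : IZR (- Z.of_nat K - 1) < IZR (Int_part x)) by (rewrite minus_IZR, opp_IZR; lra).
  assert (B : IZR (Int_part x) <= IZR (Z.of_nat K)) by lra.
  apply lt_IZR in A. apply le_IZR in B. lia.
Qed.

(** Pigeonhole argument: two powers [mu^i], [mu^j] with [i < j] fall into the same small cell of the
    square [[-1,1]^2], and dividing by [mu^i], of modulus 1, brings [mu^(j-i)] close to 1. *)
Lemma unit_power_near_one (mu : C) (eps : R) :
  Cmod mu = 1 -> 0 < eps -> exists n, (0 < n)%nat /\ Cmod (mu ^ n - 1) < eps.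
Proof.
  intros Hmu He.
  (* Cells have side [1/K]; with [K eps > 2] the two coordinate differences add up to less than
     [eps]. *)
  destruct (INR_archimed eps 2 He) as [K HK].
  assert (HK0 : 0 < INR K) by (destruct (Rle_lt_dec (INR K) 0); [nra|assumption]).
  (* The index of the interval of length [1/K] containing [x], shifted to be nonnegative on
     [[-1,1]]. The endpoint [x = 1] has index [2 K], so there are [2 K + 1] values. *)
  set (code := fun x => Z.to_nat (Int_part (INR K * x) + Z.of_nat K)).
  assert (Hcode : forall x, Rabs x <= 1 -> (code x < 2 * K + 1)%nat).
  { intros x Hx. unfold code.
    assert (Rabs (INR K * x) <= INR K)
      by (rewrite Rabs_mult, (Rabs_pos_eq (INR K)) by lra; nra).
    apply Int_part_bound in H. lia. }
  assert (Hinj : forall x y, Rabs x <= 1 -> Rabs y <= 1 -> code x = code y ->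
    INR K * Rabs (x - y) < 1).
  { intros x y Hx Hy E.
    assert (X : Rabs (INR K * x) <= INR K)
      by (rewrite Rabs_mult, (Rabs_pos_eq (INR K)) by lra; nra).
    assert (Y : Rabs (INR K * y) <= INR K)
      by (rewrite Rabs_mult, (Rabs_pos_eq (INR K)) by lra; nra).
    apply Int_part_bound in X. apply Int_part_bound in Y. unfold code in E.
    assert (E' : Int_part (INR K * x) = Int_part (INR K * y)) by lia.
    apply Int_part_eq_dist in E'. rewrite <- Rmult_minus_distr_l, Rabs_mult in E'.
    rewrite (Rabs_pos_eq (INR K)) in E' by lra. exact E'. }
  assert (Hm : forall n, Rabs (fst (mu ^ n)%C) <= 1 /\ Rabs (snd (mu ^ n)%C) <= 1).
  { intro n. pose proof (Rmax_Cmod (mu ^ n)%C) as H. rewrite Cmod_pow, Hmu, pow1 in H.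
    split; eapply Rle_trans; [apply Rmax_l|exact H|apply Rmax_r|exact H]. }
  (* The pair of indices is packed into one number in base [2 K + 1]. *)
  destruct (pigeonhole (fun n => code (fst (mu ^ n)%C) + (2 * K + 1) * code (snd (mu ^ n)%C))%nat
    ((2 * K + 1) * (2 * K + 1))) as (i & j & Hij & E).
  { intro n. destruct (Hm n) as [H1 H2]. apply Hcode in H1. apply Hcode in H2. nia. }
  destruct (Hm i) as [I1 I2], (Hm j) as [J1 J2].
  pose proof (Hcode _ I1). pose proof (Hcode _ J1).
  assert (E2 : code (snd (mu ^ i)%C) = code (snd (mu ^ j)%C)) by nia.
  assert (E1 : code (fst (mu ^ i)%C) = code (fst (mu ^ j)%C)) by nia.
  apply Hinj in E1; [|assumption..]. apply Hinj in E2; [|assumption..].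
  exists (j - i)%nat; split; [lia|].
  assert (Ei : Cmod (mu ^ i)%C = 1) by now rewrite Cmod_pow, Hmu, pow1.
  replace (Cmod (mu ^ (j - i) - 1)) with (Cmod (mu ^ i - mu ^ j)).
  2: { replace (mu ^ j)%C with (mu ^ i * mu ^ (j - i))%C by (rewrite <- Cpow_add_r; f_equal; lia).
       replace (mu ^ i - mu ^ i * mu ^ (j - i))%C with (- (mu ^ i * (mu ^ (j - i) - 1)))%C by ring.
       rewrite Cmod_opp, Cmod_mult, Ei. ring. }
  set (d := (mu ^ i - mu ^ j)%C).
  assert (Hd : Cmod d <= Rabs (fst d) + Rabs (snd d)).
  { replace d with (RtoC (fst d) + Ci * RtoC (snd d))%C at 1
      by (destruct d; unfold Ci, RtoC, Cplus, Cmult; simpl; f_equal; ring).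
    eapply Rle_trans; [apply Cmod_triangle|].
    rewrite Cmod_mult, Cmod_Ci, !Cmod_R. lra. }
  change (fst d) with (fst (mu ^ i)%C - fst (mu ^ j)%C) in Hd.
  change (snd d) with (snd (mu ^ i)%C - snd (mu ^ j)%C) in Hd.
  nra.
Qed.

Lemma conjugate_iter (phi psi : Chat -> Chat) (mu : C) (h : maps_disk phi) (n : nat) (z : disk) :
  (forall x, psi (phi x) = dilation mu (psi x)) ->
  psi (Some (Nat.iter n (disk_map phi h) z : C)) = dilation (mu ^ n) (psi (Some (z : C))).
Proof.
  intro H. induction n as [|n IH].
  - simpl. destruct (psi (Some (z : C))); simpl; [|reflexivity]. f_equal; ring.
  - simpl Nat.iter. rewrite <- disk_map_spec, H, IH.
    destruct (psi (Some (z : C))); simpl dilation; [|reflexivity].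
    f_equal; simpl; ring.
Qed.

Lemma Some_inj {T : Type} (x y : T) : Some x = Some y -> x = y.
Proof. congruence. Qed.

(** With denominators cleared the relation also covers the pole: a dilation preserves infinity, so
    both denominators vanish together and both sides are 0. *)
Lemma mobius_dilation_cross (a b c d m w z : C) :
  mobius a b c d (Some w) = dilation m (mobius a b c d (Some z)) ->
  ((a * w + b) * (c * z + d) = m * (a * z + b) * (c * w + d))%C.
Proof.
  simpl. destruct (Ceq_dec (c * w + d) 0) as [Ew|Ew], (Ceq_dec (c * z + d) 0) as [Ez|Ez];
    simpl; intro H; try discriminate.
  - rewrite Ew, Ez. ring.
  - apply Some_inj in H.
    replace (a * w + b)%C with ((a * w + b) / (c * w + d) * (c * w + d))%C by (field; assumption).
    rewrite H. field; assumption.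
Qed.

Lemma elliptic_iter_near_id (phi : Chat -> Chat) (h : maps_disk phi) (eta : R) :
  elliptic phi -> 0 < eta ->
  exists n, (0 < n)%nat /\ near_id eta (fun z => Nat.iter n (disk_map phi h) z).
Proof.
  intros (_ & _ & _ & mu & Hmu & psi & (a & b & c & d & Hdet & Hpsi) & Hconj) He.
  set (D := (a * d - b * c)%C) in *.
  assert (HD : 0 < Cmod D) by now apply Cmod_gt_0.
  set (K := Cmod (b * c) + Cmod (a * d + b * c) + Cmod (b * d) + Cmod (a * c) + 1).
  pose proof (Cmod_ge_0 (b * c)%C) as K1. pose proof (Cmod_ge_0 (a * d + b * c)%C) as K2.
  pose proof (Cmod_ge_0 (b * d)%C) as K3. pose proof (Cmod_ge_0 (a * c)%C) as K4.
  assert (HK : 0 < K) by (unfold K; lra).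
  (* The bound [/ 2] keeps [|d'| >= |D|/2] below; [eta / 2] then makes every quotient
     [(m - 1) x / d'] with [|x| <= K] at most [eta]. *)
  set (tau := Rmin (/ 2) (eta / 2) * Cmod D / K).
  assert (Hmin : 0 < Rmin (/ 2) (eta / 2)) by (apply Rmin_pos; lra).
  assert (Htau : 0 < tau)
    by (apply Rdiv_lt_0_compat; [apply Rmult_lt_0_compat; assumption|assumption]).
  destruct (unit_power_near_one mu tau Hmu Htau) as (n & Hn & Hm).
  exists n; split; [exact Hn|].
  set (m := (mu ^ n)%C) in *.
  pose proof (Cmod_ge_0 (m - 1)%C) as M0.
  assert (HmK : Cmod (m - 1) * K <= Rmin (/ 2) (eta / 2) * Cmod D).
  { replace (Rmin (/ 2) (eta / 2) * Cmod D) with (tau * K) by (unfold tau; field; lra).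
    apply Rmult_le_compat_r; lra. }
  assert (HmK1 : Cmod (m - 1) * K <= Cmod D / 2).
  { eapply Rle_trans; [exact HmK|]. pose proof (Rmin_l (/ 2) (eta / 2)). nra. }
  assert (HmK2 : Cmod (m - 1) * K <= eta / 2 * Cmod D).
  { eapply Rle_trans; [exact HmK|]. apply Rmult_le_compat_r; [lra|apply Rmin_r]. }
  (* Solving the cross-multiplied conjugacy relation for [w] gives a fraction whose denominator has
     constant term [d']. Dividing by it yields the normal form of [near_id]; at [m = 1] that form is
     the identity. *)
  set (d' := (D - (m - 1) * (b * c))%C).
  assert (Hd' : Cmod D / 2 <= Cmod d').
  { assert (Cmod D <= Cmod d' + Cmod ((m - 1) * (b * c))).
    { replace D with (d' + (m - 1) * (b * c))%C at 1 by (unfold d'; ring). apply Cmod_triangle. }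
    rewrite Cmod_mult in H.
    assert (Cmod (m - 1) * Cmod (b * c) <= Cmod (m - 1) * K)
      by (apply Rmult_le_compat_l; unfold K; lra). lra. }
  assert (Hd0 : d' <> 0%C) by (apply Cmod_gt_0; lra).
  assert (Hsmall : forall x, Cmod x <= K -> Cmod ((m - 1) * x / d') <= eta).
  { intros x Hx. rewrite Cmod_div, Cmod_mult by assumption.
    apply Rle_div_l; [lra|].
    assert (Cmod (m - 1) * Cmod x <= Cmod (m - 1) * K) by (apply Rmult_le_compat_l; assumption).
    nra. }
  exists (1 + (m - 1) * (a * d + b * c) / d')%C, ((m - 1) * (b * d) / d')%C,
    ((m - 1) * (- (a * c)) / d')%C.
  repeat split.
  - replace (1 + (m - 1) * (a * d + b * c) / d' - 1)%C with ((m - 1) * (a * d + b * c) / d')%C by ring.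
    apply Hsmall. unfold K; lra.
  - apply Hsmall. unfold K; lra.
  - apply Hsmall. rewrite Cmod_opp. unfold K; lra.
  - intro z. pose proof (conjugate_iter phi psi mu h n z Hconj) as E.
    rewrite !Hpsi in E. apply mobius_dilation_cross in E. fold m in E.
    set (w := disk_val (Nat.iter n (disk_map phi h) z)) in *.
    assert (E' : (w * (d' + (m - 1) * - (a * c) * z)
      = (d' + (m - 1) * (a * d + b * c)) * z + (m - 1) * (b * d))%C).
    { unfold d', D.
      match goal with |- ?l = ?r =>
        replace l with (r + ((a * w + b) * (c * z + d) - m * (a * z + b) * (c * w + d)))%C by ring
      end.
      rewrite E. ring. }
    replace (w * (1 + (m - 1) * - (a * c) / d' * z))%C
      with (w * (d' + (m - 1) * - (a * c) * z) / d')%C by (field; assumption).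
    rewrite E'. field; assumption.
Qed.

(** * Recurrence *)

Lemma iter_comp_op (psi : disk -> disk) (n : nat) (f : disk -> C) (z : disk) :
  Nat.iter n (comp_op psi) f z = f (Nat.iter n psi z).
Proof.
  revert z; induction n as [|n IH]; intro z; [reflexivity|].
  rewrite (Nat.iter_succ_r n _ psi). simpl. unfold comp_op at 1. apply IH.
Qed.

(** A polynomial [P] in [U] is itself the recurrent witness: [P o psi^n] lies in a ball around [P]
    contained in [U]. *)
Lemma recurrent_of_near_id (nu : R) (psi : disk -> disk) :
  (forall eta, 0 < eta ->
    exists n, (0 < n)%nat /\ near_id eta (fun z => Nat.iter n psi z)) ->
  recurrent nu (comp_op psi).
Proof.
  intros Hpsi U [US UO] [f Hf].
  destruct (has_norm_dominated nu) as (K & K0 & HK).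
  destruct (UO f Hf) as (e1 & He1 & H1).
  destruct (poly_dense nu f e1 (US f Hf) He1) as (a & N & r1 & Hr1 & Hlt1).
  destruct (poly_dominated a N) as (M0 & M0pos & HM0).
  assert (HP : U (fun z : disk => cpoly a N z)).
  { apply (H1 _ r1); [|exact Hr1|exact Hlt1].
    destruct (HK _ _ M0pos HM0) as (r & Hr & _). now exists r. }
  destruct (UO _ HP) as (e2 & He2 & H2).
  destruct (poly_near_id a N) as (M & Mpos & HM).
  assert (HKM : 0 < K * M + 1) by nra.
  (* [/ 4] is the range of [poly_near_id]; the [+ 1] makes [K (eta M) < e2] strict and the division
     legitimate. *)
  set (eta := Rmin (/ 4) (e2 / (K * M + 1))).
  assert (Heta : 0 < eta) by (apply Rmin_pos; [lra|now apply Rdiv_lt_0_compat]).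
  assert (Heta4 : eta <= / 4) by apply Rmin_l.
  assert (HetaM : eta * (K * M + 1) <= e2).
  { apply Rle_div_r; [exact HKM|apply Rmin_r]. }
  destruct (Hpsi eta Heta) as (n & Hn & Hw).
  exists n; split; [exact Hn|]. exists (fun z : disk => cpoly a N z); split; [exact HP|].
  assert (HD : dominated (eta * M)
    (fun z => Nat.iter n (comp_op psi) (fun z : disk => cpoly a N z) z - cpoly a N z)%C).
  { refine (dominated_ext _ _ _ _ (HM eta _ _ Hw)); [|lra].
    intro z. now rewrite iter_comp_op. }
  destruct (HK _ _ (Rmult_le_pos _ _ (Rlt_le _ _ Heta) Mpos) HD) as (r & Hr & Hrle).
  apply (H2 _ r); [|exact Hr|nra].
  (* Openness only speaks of members of [S_nu], so membership of [P o psi^n] is obtained from the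
     difference plus [P]. *)
  assert (HS : dominated (eta * M + M0)
    (Nat.iter n (comp_op psi) (fun z : disk => cpoly a N z))).
  { refine (dominated_ext _ _ _ _ (dominated_plus _ _ _ _ HD HM0)). intro z; cbv beta; ring. }
  assert (Hsum : 0 <= eta * M + M0) by nra.
  destruct (HK _ _ Hsum HS) as (r' & Hr' & _). now exists r'.
Qed.

(** * Lipschitz bounds in [S_nu] and the obstruction to recurrence *)

Lemma Cpow_lipschitz (R0 : R) (z w : C) (n : nat) :
  Cmod z <= R0 -> Cmod w <= R0 ->
  Cmod (z ^ n - w ^ n) * R0 <= INR n * R0 ^ n * Cmod (z - w).
Proof.
  intros Hz Hw. pose proof (Cmod_ge_0 z). pose proof (Cmod_ge_0 (z - w)).
  assert (R0pos : 0 <= R0) by lra.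
  (* The usual constant [n R0^(n-1)] is multiplied through by [R0], which avoids the exponent
     [n - 1]. *)
  induction n as [|n IH].
  - simpl. replace (1 - 1)%C with (RtoC 0) by ring. rewrite Cmod_0; lra.
  - rewrite S_INR. rewrite !Cpow_S.
    replace (z * z ^ n - w * w ^ n)%C with (z * (z ^ n - w ^ n) + (z - w) * w ^ n)%C by ring.
    pose proof (Cmod_triangle (z * (z ^ n - w ^ n)) ((z - w) * w ^ n)) as T.
    rewrite !Cmod_mult, Cmod_pow in T.
    pose proof (pow_incr _ _ n (conj (Cmod_ge_0 w) Hw)) as P.
    pose proof (Cmod_ge_0 (z ^ n - w ^ n)).
    assert (A1 : Cmod z * (Cmod (z ^ n - w ^ n) * R0) <= R0 * (INR n * R0 ^ n * Cmod (z - w))).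
    { apply Rmult_le_compat; [assumption|now apply Rmult_le_pos|assumption|assumption]. }
    assert (A2 : Cmod (z - w) * Cmod w ^ n <= Cmod (z - w) * R0 ^ n)
      by (apply Rmult_le_compat_l; assumption).
    apply Rmult_le_compat_r with (r := R0) in T; [|assumption].
    apply Rmult_le_compat_r with (r := R0) in A2; [|assumption].
    simpl pow. lra.
Qed.

Lemma has_norm_coef (nu : R) (a : nat -> C) (r : R) (n : nat) :
  0 <= r ->
  is_series (fun n : nat => Cmod (a n) ^ 2 * Rpower (INR n + 1) (2 * nu)) (r ^ 2) ->
  Cmod (a n) <= r * Rpower (INR n + 1) (- nu).
Proof.
  intros r0 H. pose proof (Rpower_pos (INR n + 1) nu) as P. pose proof (Cmod_ge_0 (a n)).
  assert (Ht : forall n : nat, 0 <= Cmod (a n) ^ 2 * Rpower (INR n + 1) (2 * nu)).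
  { intro k. apply Rmult_le_pos; [apply pow2_ge_0|left; apply Rpower_pos]. }
  pose proof (sum_n_le_series _ _ Ht H n) as L.
  assert (L' : Cmod (a n) ^ 2 * Rpower (INR n + 1) (2 * nu) <= r ^ 2).
  { eapply Rle_trans; [|exact L]. destruct n as [|n]; [rewrite sum_O; lra|].
    rewrite sum_Sn. change plus with Rplus.
    assert (0 <= sum_n (fun n : nat => Cmod (a n) ^ 2 * Rpower (INR n + 1) (2 * nu)) n); [|lra].
    clear - Ht. induction n as [|n IH]; [rewrite sum_O; apply Ht|].
    rewrite sum_Sn. change plus with Rplus. specialize (Ht (S n)); lra. }
  replace (2 * nu) with (nu + nu) in L' by ring. rewrite Rpower_plus in L'.
  rewrite Rpower_Ropp. apply Rle_div_r; [exact P|].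
  apply Rsqr_incr_0_var; [unfold Rsqr; lra|exact r0].
Qed.

(** Termwise, [|a_n| <= r (n+1)^-nu] and [|z^n - w^n| <= (n+1) R0^n |z - w| / R0]; the series of
    [(n+1)^(1-nu) R0^n] converges to [S]. The [+ 1] in [L = S / R0 + 1] secures [L > 0]. *)
Lemma has_norm_lipschitz (nu R0 : R) :
  0 < R0 < 1 ->
  exists L, 0 < L /\ forall h r, has_norm nu h r -> forall z w : disk,
    Cmod z <= R0 -> Cmod w <= R0 -> Cmod (h z - h w) <= L * r * Cmod (z - w).
Proof.
  intro HR. destruct (ex_series_Rpower_geom (1 - nu) R0 HR) as [S HS].
  change R in (type of S).
  assert (S0 : 0 <= S).
  { refine (series_nonneg _ _ _ HS). intro n.
    apply Rmult_le_pos; [left; apply Rpower_pos|apply pow_le; lra]. }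
  exists (S / R0 + 1); split.
  { assert (0 <= S / R0) by (apply Rle_div_r; lra). lra. }
  intros h r (r0 & a & Ha & Hr) z w Hz Hw. rewrite is_power_series_iff in Ha.
  pose proof (Cmod_ge_0 (z - w)).
  apply Rle_trans with (r * Cmod (z - w) / R0 * S).
  2: { assert (0 <= r * Cmod (z - w)) by now apply Rmult_le_pos.
       replace ((S / R0 + 1) * r * Cmod (z - w)) with
         (r * Cmod (z - w) / R0 * S + r * Cmod (z - w)) by (field; lra). lra. }
  refine (cseries_bound _ _ _ _ (is_series_minus _ _ _ _ (Ha z) (Ha w))
    (is_series_scal_l (r * Cmod (z - w) / R0) _ _ HS) _).
  intro n.
  change (Cmod ((z : C) ^ n * a n - w ^ n * a n)
    <= r * Cmod (z - w) / R0 * (Rpower (INR n + 1) (1 - nu) * R0 ^ n)).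
  replace ((z : C) ^ n * a n - w ^ n * a n)%C with (((z : C) ^ n - w ^ n) * a n)%C by ring.
  rewrite Cmod_mult.
  pose proof (has_norm_coef nu a r n r0 Hr) as Hc.
  pose proof (Cpow_lipschitz R0 z w n Hz Hw) as Hl.
  pose proof (INR_S_pos n) as In. pose proof (pow_lt R0 n (proj1 HR)) as Rn.
  replace (1 - nu) with (1 + - nu) by ring. rewrite Rpower_plus, Rpower_1 by exact In.
  replace (r * Cmod (z - w) / R0 * ((INR n + 1) * Rpower (INR n + 1) (- nu) * R0 ^ n))
    with ((INR n + 1) * R0 ^ n * Cmod (z - w) / R0 * (r * Rpower (INR n + 1) (- nu)))
    by (field; lra).
  apply Rmult_le_compat; try apply Cmod_ge_0; [|exact Hc].
  apply Rle_div_r; [lra|]. eapply Rle_trans; [exact Hl|].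
  apply Rmult_le_compat_r; [assumption|]. apply Rmult_le_compat_r; lra.
Qed.

Lemma disk_eq (z w : disk) : (z : C) = w -> z = w.
Proof.
  destruct z as [z Hz], w as [w Hw]; simpl; intros ->. f_equal. apply Classical_Prop.proof_irrelevance.
Qed.

(** As [k < 1], the orbit stays in the ball where [psi] contracts; one factor [k], uniform in
    [n > 0], is kept. *)
Lemma iter_contraction (psi : disk -> disk) (p : disk) (k rho : R) (n : nat) (z : disk) :
  0 <= k < 1 ->
  (forall z : disk, Cmod (z - p) < rho -> Cmod (psi z - p) <= k * Cmod (z - p)) ->
  Cmod (z - p) < rho -> (0 < n)%nat -> Cmod (Nat.iter n psi z - p) <= k * Cmod (z - p).
Proof.
  intros Hk Hpsi Hz Hn. destruct n as [|n]; [lia|clear Hn].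
  induction n as [|n IH]; [now apply Hpsi|].
  pose proof (Cmod_ge_0 (z - p)). simpl Nat.iter in *.
  assert (L : Cmod (psi (Nat.iter n psi z) - p) < rho) by nra.
  specialize (Hpsi _ L). pose proof (Cmod_ge_0 (psi (Nat.iter n psi z) - p)). nra.
Qed.

Lemma contraction_not_recurrent (nu : R) (psi : disk -> disk) (p : disk) (k rho : R) :
  0 <= k < 1 -> 0 < rho ->
  (forall z : disk, Cmod (z - p) < rho -> Cmod (psi z - p) <= k * Cmod (z - p)) ->
  ~ recurrent nu (comp_op psi).
Proof.
  intros Hk Hrho Hpsi Hrec. pose proof (disk_lt p) as Hp.
  (* The smaller radius places the ball in [|z| <= R0 < 1], where the Lipschitz bound holds. *)
  set (rho' := Rmin rho ((1 - Cmod p) / 2)).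
  assert (Hrho' : 0 < rho') by (apply Rmin_pos; lra).
  assert (Hr1 : rho' <= rho) by apply Rmin_l.
  assert (Hr2 : rho' <= (1 - Cmod p) / 2) by apply Rmin_r.
  set (R0 := (1 + Cmod p) / 2). pose proof (Cmod_ge_0 p) as Hp0.
  assert (HR0 : 0 < R0 < 1) by (unfold R0; lra).
  assert (Hball : forall z : C, Cmod (z - p) < rho' -> Cmod z <= R0).
  { intros z Hz. replace z with (p + (z - p))%C by ring.
    pose proof (Cmod_triangle p (z - p)). unfold R0. lra. }
  destruct (has_norm_lipschitz nu R0 HR0) as (L & HL & Hlip).
  (* [k (1 + del) < 1 - del] *)
  set (del := (1 - k) / 4). assert (Hdel : 0 < del) by (unfold del; lra).
  (* The strict inequality [d < del] leaves room for perturbation: a change of norm [r] raises [d]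
     by at most [L r], which makes [U] open. The coordinate function belongs to [U] with [d = 0]. *)
  set (U := fun f => in_S nu f /\ exists d, 0 <= d < del /\
    forall z : disk, Cmod (z - p) < rho' ->
      Cmod (f z - f p - (z - p)) <= d * Cmod (z - p)).
  assert (psip : psi p = p).
  { apply disk_eq. assert (E : Cmod (p - p) = 0)
      by (replace (p - p)%C with (RtoC 0) by ring; apply Cmod_0).
    specialize (Hpsi p). rewrite E in Hpsi. specialize (Hpsi Hrho).
    assert (E' : Cmod (psi p - p) = 0) by (pose proof (Cmod_ge_0 (psi p - p)); lra).
    apply Cmod_eq_0 in E'. replace (psi p : C) with (psi p - p + p)%C by ring.
    rewrite E'. ring. }
  assert (UO : open_in_S nu U).
  { split; [now intros f [Hf _]|].
    intros f (Hf & d & Hd & Hfd).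
    exists ((del - d) / (2 * L)). split; [apply Rdiv_lt_0_compat; lra|].
    intros g r Hg Hr Hre. split; [exact Hg|].
    assert (HrL : L * r < (del - d) / 2).
    { apply (Rmult_lt_compat_l L) in Hre; [|exact HL].
      replace (L * ((del - d) / (2 * L))) with ((del - d) / 2) in Hre by (field; lra). exact Hre. }
    pose proof (proj1 Hr) as r0.
    exists (d + L * r). split; [nra|].
    intros z Hz. specialize (Hfd z Hz).
    specialize (Hlip _ _ Hr z p (Hball _ Hz) (ltac:(unfold R0; lra))). cbv beta in Hlip.
    replace (g z - g p - (z - p))%C with
      ((f z - f p - (z - p)) + (g z - f z - (g p - f p)))%C by ring.
    eapply Rle_trans; [apply Cmod_triangle|]. lra. }
  destruct (Hrec U UO) as (n & Hn & f & (_ & d & Hd & Hfd) & (_ & d' & Hd' & Hfd')).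
  { exists (fun z => z : C). split.
    - destruct (has_norm_dominated nu) as (K & _ & HK).
      destruct (HK (2 * 1) (fun z => z : C)) as (r & Hr & _); [lra| |now exists r].
      refine (dominated_ext _ _ _ _ (dominated_mul_z _ _ Rle_0_1 dominated_one)).
      intro z; cbv beta; ring.
    - exists 0. split; [lra|]. intros z _.
      replace (z - p - (z - p))%C with (RtoC 0) by ring. rewrite Cmod_0; lra. }
  assert (Hz0 : Cmod (p + RtoC (rho' / 2)) < 1).
  { eapply Rle_lt_trans; [apply Cmod_triangle|]. rewrite Cmod_R, Rabs_pos_eq; lra. }
  set (z0 := exist _ _ Hz0 : disk).
  assert (Dz : Cmod (z0 - p) = rho' / 2).
  { simpl. replace (p + RtoC (rho' / 2) - p)%C with (RtoC (rho' / 2)) by ring.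
    rewrite Cmod_R, Rabs_pos_eq; lra. }
  assert (Hz0' : Cmod (z0 - p) < rho') by lra.
  assert (Hcon := iter_contraction psi p k rho n z0 Hk Hpsi (Rlt_le_trans _ _ _ Hz0' Hr1) Hn).
  assert (itp : Nat.iter n psi p = p).
  { clear - psip. induction n as [|n IH]; simpl; congruence. }
  specialize (Hfd' z0 Hz0'). rewrite !iter_comp_op, itp in Hfd'.
  set (w := Nat.iter n psi z0) in *.
  specialize (Hfd w (ltac:(nra))).
  assert (T1 : Cmod (f w - f p) <= (1 + d) * Cmod (w - p)).
  { replace (f w - f p)%C with ((f w - f p - (w - p)) + (w - p))%C by ring.
    eapply Rle_trans; [apply Cmod_triangle|]. lra. }
  (* Here [f w] is the value at [z0] of the iterate. With [T1] and the contraction, dividing by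
     [|z0 - p|] gives [1 <= (1 + d) k + d'], while the right side is below
     [k + 2 del = (1 + k)/2 < 1]. *)
  assert (T2 : Cmod (z0 - p) <= Cmod (f w - f p) + Cmod (f w - f p - (z0 - p))).
  { replace (z0 - p)%C with ((f w - f p) + - (f w - f p - (z0 - p)))%C at 1 by ring.
    eapply Rle_trans; [apply Cmod_triangle|]. rewrite Cmod_opp. lra. }
  rewrite Dz in *. unfold del in *.
  assert (T3 : (1 + d) * Cmod (w - p) <= (1 + d) * (k * (rho' / 2)))
    by (apply Rmult_le_compat_l; lra).
  assert (T4 : d * (rho' / 2) <= del * (rho' / 2)) by (apply Rmult_le_compat_r; unfold del; lra).
  assert (T5 : d' * (rho' / 2) <= del * (rho' / 2)) by (apply Rmult_le_compat_r; unfold del; lra).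
  assert (T6 : d * k <= del) by (unfold del; nra).
  unfold del in *. nra.
Qed.

(** * Linear fractional maps with a fixed point in the disk *)

Lemma mobius_Some (a b c d z : C) :
  (c * z + d)%C <> 0%C -> mobius a b c d (Some z) = Some ((a * z + b) / (c * z + d))%C.
Proof. intro H. simpl. now destruct (Ceq_dec (c * z + d) 0). Qed.

Lemma mobius_Some_inf (a b c d z : C) :
  (c * z + d)%C = 0%C -> mobius a b c d (Some z) = None.
Proof. intro H. simpl. now destruct (Ceq_dec (c * z + d) 0). Qed.

Lemma mobius_None (a b c d : C) :
  c <> 0%C -> mobius a b c d None = Some (a / c)%C.
Proof. intro H. simpl. now destruct (Ceq_dec c 0). Qed.

Lemma mobius_None_inf (a b c d : C) :
  c = 0%C -> mobius a b c d None = None.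
Proof. intro H. simpl. now destruct (Ceq_dec c 0). Qed.

Lemma mobius_scale (k a b c d : C) (x : Chat) :
  k <> 0%C -> mobius (k * a) (k * b) (k * c) (k * d) x = mobius a b c d x.
Proof.
  intro Hk. destruct x as [z|].
  - destruct (Ceq_dec (c * z + d) 0) as [E|E].
    + rewrite !mobius_Some_inf; [reflexivity|exact E|].
      replace (k * c * z + k * d)%C with (k * (c * z + d))%C by ring. rewrite E; ring.
    + assert (E' : (k * c * z + k * d)%C <> 0%C).
      { replace (k * c * z + k * d)%C with (k * (c * z + d))%C by ring.
        now apply Cmult_neq_0. }
      rewrite !mobius_Some by assumption. f_equal. field. now split.
  - destruct (Ceq_dec c 0) as [E|E].
    + rewrite !mobius_None_inf; [reflexivity|exact E|rewrite E; ring].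
    + rewrite !mobius_None; [f_equal; field; now split|exact E|now apply Cmult_neq_0].
Qed.

(** Composition is the matrix product. The determinant of the inner map enters at points sent to
    infinity: there its numerator cannot vanish too. *)
Lemma mobius_comp (a b c d a' b' c' d' : C) (x : Chat) :
  (a' * d' - b' * c')%C <> 0%C ->
  mobius a b c d (mobius a' b' c' d' x) =
  mobius (a * a' + b * c') (a * b' + b * d') (c * a' + d * c') (c * b' + d * d') x.
Proof.
  intro Hdet. destruct x as [z|].
  - destruct (Ceq_dec (c' * z + d') 0) as [E|E].
    + rewrite (mobius_Some_inf a' b' c' d') by exact E.
      assert (N : (a' * z + b')%C <> 0%C).
      { intro N. apply Hdet.
        replace d' with (- (c' * z) + (c' * z + d'))%C by ring. rewrite E.
        replace (a' * (- (c' * z) + 0) - b' * c')%C with (- c' * (a' * z + b'))%C by ring.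
        rewrite N; ring. }
      replace d' with (- (c' * z))%C in *
        by (replace (- (c' * z))%C with (d' - (c' * z + d'))%C by ring; rewrite E; ring).
      destruct (Ceq_dec c 0) as [C0|C0].
      * rewrite mobius_None_inf, mobius_Some_inf; [reflexivity| |exact C0]. rewrite C0; ring.
      * assert (N' : ((c * a' + d * c') * z + (c * b' + d * - (c' * z)))%C <> 0%C).
        { replace ((c * a' + d * c') * z + (c * b' + d * - (c' * z)))%C
            with (c * (a' * z + b'))%C by ring. now apply Cmult_neq_0. }
        rewrite mobius_None, mobius_Some by assumption.
        f_equal. field. now split.
    + rewrite (mobius_Some a' b' c' d') by exact E.
      set (w := ((a' * z + b') / (c' * z + d'))%C).
      assert (W1 : ((c * w + d) * (c' * z + d') = (c * a' + d * c') * z + (c * b' + d * d'))%C)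
        by (unfold w; field; exact E).
      assert (W2 : ((a * w + b) * (c' * z + d') = (a * a' + b * c') * z + (a * b' + b * d'))%C)
        by (unfold w; field; exact E).
      destruct (Ceq_dec (c * w + d) 0) as [E'|E'].
      * rewrite !mobius_Some_inf; [reflexivity| |exact E']. rewrite <- W1, E'. ring.
      * rewrite !mobius_Some; [|rewrite <- W1; now apply Cmult_neq_0|exact E'].
        f_equal. rewrite <- W1, <- W2. field. now split.
  - destruct (Ceq_dec c' 0) as [E|E].
    + rewrite (mobius_None_inf a' b' c' d') by exact E.
      assert (N : a' <> 0%C) by (intro N; apply Hdet; rewrite N, E; ring).
      rewrite E. destruct (Ceq_dec c 0) as [C0|C0].
      * rewrite !mobius_None_inf; [reflexivity|rewrite C0; ring|exact C0].
      * replace (c * a' + d * 0)%C with (c * a')%C by ring.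
        rewrite !mobius_None; [f_equal; field; now split|now apply Cmult_neq_0|exact C0].
    + rewrite (mobius_None a' b' c' d') by exact E.
      set (w := (a' / c')%C).
      assert (W1 : ((c * w + d) * c' = c * a' + d * c')%C) by (unfold w; field; exact E).
      assert (W2 : ((a * w + b) * c' = a * a' + b * c')%C) by (unfold w; field; exact E).
      destruct (Ceq_dec (c * w + d) 0) as [E'|E'].
      * rewrite mobius_Some_inf, mobius_None_inf; [reflexivity| |exact E']. rewrite <- W1, E'. ring.
      * rewrite mobius_Some, mobius_None; [|rewrite <- W1; now apply Cmult_neq_0|exact E'].
        f_equal. rewrite <- W1, <- W2. field. now split.
Qed.

Lemma mobius_scalar (k : C) (x : Chat) : k <> 0%C -> mobius k 0 0 k x = x.
Proof.
  intro Hk. destruct x as [z|].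
  - rewrite mobius_Some by (replace (0 * z + k)%C with k by ring; exact Hk).
    f_equal. field. exact Hk.
  - now apply mobius_None_inf.
Qed.

Lemma dilation_mobius (m a b c d : C) (x : Chat) :
  dilation m (mobius a b c d x) = mobius (m * a) (m * b) c d x.
Proof.
  destruct x as [z|]; simpl.
  - destruct (Ceq_dec (c * z + d) 0) as [E|E]; simpl; [reflexivity|]. f_equal. field. exact E.
  - destruct (Ceq_dec c 0) as [E|E]; simpl; [reflexivity|]. f_equal. field. exact E.
Qed.

(** This is [phi(z) - p = l (z - p) / (1 + c (z - p))] written as a matrix, scaled so that the
    denominator is 1 at [p]. The multiplier [l] is the derivative at [p], the determinant over the
    squared denominator at [p]. *)
Lemma mobius_fixing (phi : Chat -> Chat) (p : C) :
  linear_fractional phi -> phi (Some p) = Some p ->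
  exists l c : C, l <> 0%C /\
    forall x, phi x = mobius (l + c * p) (p - l * p - c * p * p) c (1 - c * p) x.
Proof.
  intros (a & b & c & d & Hdet & Hphi) Hp. rewrite Hphi in Hp.
  destruct (Ceq_dec (c * p + d) 0) as [E|E].
  { rewrite mobius_Some_inf in Hp by exact E. discriminate. }
  rewrite mobius_Some in Hp by exact E. apply Some_inj in Hp.
  set (k := (c * p + d)%C) in *.
  assert (Hk : (a * p + b = p * k)%C) by (rewrite <- Hp at 2; field; exact E).
  exists ((a * d - b * c) / (k * k))%C, (c / k)%C. split.
  - intro H. apply Hdet.
    replace (a * d - b * c)%C with ((a * d - b * c) / (k * k) * (k * k))%C by (field; exact E).
    rewrite H; ring.
  - intro x. rewrite Hphi.
    replace (a * d - b * c)%C with (a * k - c * (p * k))%C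
      by (rewrite <- Hk; unfold k; ring).
    rewrite <- (mobius_scale k _ _ (c / k)) by exact E.
    f_equal.
    + field. exact E.
    + replace b with (p * k - a * p)%C by (rewrite <- Hk; ring). field. exact E.
    + field. exact E.
    + replace d with (k - c * p)%C by (unfold k; ring). field. exact E.
Qed.

Lemma fixing_eq (l c p z w : C) :
  mobius (l + c * p) (p - l * p - c * p * p) c (1 - c * p) (Some z) = Some w ->
  ((w - p) * (1 + c * (z - p)) = l * (z - p))%C.
Proof.
  destruct (Ceq_dec (c * z + (1 - c * p)) 0) as [E|E].
  - rewrite mobius_Some_inf by exact E. discriminate.
  - rewrite mobius_Some by exact E. intro H. apply Some_inj in H. rewrite <- H.
    field. exact E.
Qed.

(** * Disk automorphisms and a Schwarz-type inequality *)

Lemma Cmod_disk_automorphism (p z : C) :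
  Cmod (1 + Cconj p * z) ^ 2 - Cmod (z + p) ^ 2 = (1 - Cmod z ^ 2) * (1 - Cmod p ^ 2).
Proof.
  rewrite !Cmod2_alt. destruct p, z. unfold Re, Im, Cconj. simpl. ring.
Qed.

Lemma disk_automorphism_lt (p z : C) :
  Cmod p < 1 -> Cmod z < 1 ->
  (1 + Cconj p * z)%C <> 0%C /\ Cmod ((z + p) / (1 + Cconj p * z)) < 1.
Proof.
  intros Hp Hz. pose proof (Cmod_disk_automorphism p z) as H.
  pose proof (Cmod_ge_0 p). pose proof (Cmod_ge_0 z).
  pose proof (Cmod_ge_0 (1 + Cconj p * z)). pose proof (Cmod_ge_0 (z + p)).
  assert (0 < (1 - Cmod z ^ 2) * (1 - Cmod p ^ 2)) by (apply Rmult_lt_0_compat; nra).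
  assert (L : Cmod (z + p) < Cmod (1 + Cconj p * z)) by nra.
  assert (N : (1 + Cconj p * z)%C <> 0%C) by (apply Cmod_gt_0; lra).
  split; [exact N|]. rewrite Cmod_div by exact N. apply Rlt_div_l; lra.
Qed.

Lemma one_minus_conj_neq_0 (p : C) : Cmod p < 1 -> (1 - Cconj p * p)%C <> 0%C.
Proof.
  intro Hp. replace (1 - Cconj p * p)%C with (1 + Cconj p * (- p))%C by ring.
  apply disk_automorphism_lt; [exact Hp|now rewrite Cmod_opp].
Qed.

(** The hypothesis bounds [l u / (1 + s u)] by 1 on the disk; it is tightest in the direction [e]
    with [s e = - |s|], near the boundary. *)
Lemma schwarz_ineq (l s : C) :
  l <> 0%C ->
  (forall u, Cmod u < 1 -> Cmod l * Cmod u <= Cmod (1 + s * u)) ->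
  Cmod l + Cmod s <= 1.
Proof.
  intros Hl H.
  assert (He : exists e, Cmod e = 1 /\ (s * e = - RtoC (Cmod s))%C).
  { destruct (Ceq_dec s 0) as [E|E].
    - exists (RtoC 1). rewrite E, Cmod_1, Cmod_0. split; [reflexivity|ring].
    - pose proof (proj1 (Cmod_gt_0 s) E) as S0.
      assert (S1 : RtoC (Cmod s) <> 0%C) by (intro X; apply RtoC_inj in X; lra).
      exists (- (Cconj s / Cmod s))%C. split.
      + rewrite Cmod_opp, Cmod_div, Cmod_conj, Cmod_R, Rabs_pos_eq by (assumption || lra).
        field; lra.
      + replace (s * - (Cconj s / Cmod s))%C with (- ((s * Cconj s) / Cmod s))%C by (field; exact S1).
        rewrite <- Cmod2_conj, RtoC_pow. simpl. field. exact S1. }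
  destruct He as (e & He1 & He2).
  (* Test on [u = t e], where [|1 + s u| = |1 - t |s||] is smallest. *)
  assert (Ht : forall t, 0 <= t < 1 -> Cmod l * t <= Rabs (1 - t * Cmod s)).
  { intros t Ht. specialize (H (t * e)%C).
    rewrite Cmod_mult, Cmod_R, Rabs_pos_eq, He1, Rmult_1_r in H by lra.
    replace (1 + s * (t * e))%C with (RtoC (1 - t * Cmod s)) in H.
    - rewrite Cmod_R in H. apply H; lra.
    - replace (s * (t * e))%C with (t * (s * e))%C by ring.
      rewrite He2, RtoC_minus, RtoC_mult. ring. }
  pose proof (proj1 (Cmod_gt_0 l) Hl) as L0. pose proof (Cmod_ge_0 s) as S0.
  assert (S1 : Cmod s <= 1).
  (* If [|s| > 1], the pole lies in the disk: [t = 1/|s|] makes the right side 0. *)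
  { destruct (Rle_lt_dec (Cmod s) 1) as [|S1]; [assumption|exfalso].
    assert (I : 0 < / Cmod s < 1).
    { split; [apply Rinv_0_lt_compat; lra|]. rewrite <- Rinv_1. apply Rinv_lt_contravar; lra. }
    specialize (Ht (/ Cmod s) (ltac:(lra))).
    rewrite Rinv_l, Rminus_diag, Rabs_R0 in Ht by lra. nra. }
  destruct (Rle_lt_dec (Cmod l + Cmod s) 1) as [|S2]; [assumption|exfalso].
  set (x := Cmod l + Cmod s) in *.
  (* If [x > 1], the point [t = 2/(1 + x)] lies strictly between [1/x] and 1, whereas [Ht] at [t]
     says [t x <= 1]. *)
  assert (I : 0 < 2 / (1 + x) < 1).
  { split; [apply Rdiv_lt_0_compat; lra|]. apply Rlt_div_l; lra. }
  specialize (Ht (2 / (1 + x)) (ltac:(lra))).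
  rewrite Rabs_pos_eq in Ht by nra.
  assert (2 / (1 + x) * x <= 1) by (unfold x in *; lra).
  assert (2 / (1 + x) * (1 + x) = 2) by (field; lra). nra.
Qed.

(** Moving [p] to 0 by a disk automorphism turns [psi] into [U = l u / (1 + s u)], with [s] the
    second term of the bound; then [|U| < 1] is the hypothesis of [schwarz_ineq]. *)
Lemma fixing_disk_bound (l c : C) (p : disk) (psi : disk -> disk) :
  l <> 0%C ->
  (forall z : disk, ((psi z - p) * (1 + c * (z - p)) = l * (z - p))%C) ->
  Cmod l + Cmod (Cconj p * (1 - l) + c * (1 - Cconj p * p)) <= 1.
Proof.
  intros Hl Hpsi. apply schwarz_ineq; [exact Hl|]. intros u Hu.
  pose proof (disk_lt p) as Hp.
  destruct (disk_automorphism_lt p u Hp Hu) as [N Hz].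
  pose (z := exist _ _ Hz : disk). specialize (Hpsi z).
  pose proof (disk_lt (psi z)) as Hw.
  rewrite <- Cmod_opp in Hp.
  destruct (disk_automorphism_lt (- p) (psi z) Hp Hw) as [N' HU].
  set (w := disk_val (psi z)) in *. unfold z in Hpsi. simpl disk_val in Hpsi.
  set (U := ((w + - p) / (1 + Cconj (- p) * w))%C) in *.
  pose proof (Copp_conj p) as Cn.
  assert (E : (U * (1 + (Cconj p * (1 - l) + c * (1 - Cconj p * p)) * u) = l * u)%C).
  { rewrite Cn in *.
    assert (Hpsi' : ((w - p) * (1 + Cconj p * u + c * (u * (1 - Cconj p * p)))
      = l * (u * (1 - Cconj p * p)))%C).
    { replace (l * (u * (1 - Cconj p * p)))%C with
        (l * ((u + p) / (1 + Cconj p * u) - p) * (1 + Cconj p * u))%C by (field; exact N).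
      rewrite <- Hpsi. field. exact N. }
    unfold U. rewrite Cn.
    replace (((w + - p) / (1 + - Cconj p * w)) *
      (1 + (Cconj p * (1 - l) + c * (1 - Cconj p * p)) * u))%C with
      (((w - p) * (1 + Cconj p * u + c * (u * (1 - Cconj p * p))) - l * u * Cconj p * (w - p))
        / (1 + - Cconj p * w))%C by (field; exact N').
    rewrite Hpsi'. field. exact N'. }
  apply (f_equal Cmod) in E. rewrite !Cmod_mult in E.
  pose proof (Cmod_ge_0 (1 + (Cconj p * (1 - l) + c * (1 - Cconj p * p)) * u)).
  rewrite <- E. nra.
Qed.

Lemma fixing_contraction (l c : C) (p : disk) (psi : disk -> disk) :
  Cmod l < 1 ->
  (forall z : disk, ((psi z - p) * (1 + c * (z - p)) = l * (z - p))%C) ->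
  exists k rho, 0 <= k < 1 /\ 0 < rho /\
    forall z : disk, Cmod (z - p) < rho -> Cmod (psi z - p) <= k * Cmod (z - p).
Proof.
  intros Hl Hpsi. pose proof (Cmod_ge_0 l). pose proof (Cmod_ge_0 c).
  (* The radius makes [|c (z - p)| <= (1 - |l|)/2], so the denominator is at least
     [k = (1 + |l|)/2]; the [+ 1] covers [c = 0]. The quotient [|l| / k] is at most [k] because
     [|l| <= ((1 + |l|)/2)^2]. *)
  exists ((1 + Cmod l) / 2), ((1 - Cmod l) / (2 * (Cmod c + 1))).
  split; [lra|]. split; [apply Rdiv_lt_0_compat; lra|].
  intros z Hz. pose proof (Cmod_ge_0 (z - p)). pose proof (Cmod_ge_0 (psi z - p)).
  apply Rlt_div_r in Hz; [|lra].
  assert (D : (1 + Cmod l) / 2 <= Cmod (1 + c * (z - p))).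
  { pose proof (Cmod_triangle (1 + c * (z - p)) (- (c * (z - p)))) as T.
    replace (1 + c * (z - p) + - (c * (z - p)))%C with (RtoC 1) in T by ring.
    rewrite Cmod_1, Cmod_opp, Cmod_mult in T. nra. }
  pose proof (f_equal Cmod (Hpsi z)) as E. rewrite !Cmod_mult in E.
  assert (A : Cmod (psi z - p) * ((1 + Cmod l) / 2) <= Cmod l * Cmod (z - p))
    by (rewrite <- E; apply Rmult_le_compat_l; assumption).
  assert (B : Cmod l * Cmod (z - p) <= ((1 + Cmod l) / 2 * ((1 + Cmod l) / 2)) * Cmod (z - p))
    by (apply Rmult_le_compat_r; nra).
  nra.
Qed.

(** For [|p| < 1], the disk automorphism taking 0 to [p], with inverse [disk_aut (- p)]. *)
Definition disk_aut (p : C) (x : Chat) : Chat := mobius 1 p (Cconj p) 1 x.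

Lemma disk_aut_Some (p z : C) :
  Cmod p < 1 -> Cmod z < 1 ->
  disk_aut p (Some z) = Some ((z + p) / (1 + Cconj p * z))%C.
Proof.
  intros Hp Hz. destruct (disk_automorphism_lt p z Hp Hz) as [N _].
  unfold disk_aut. rewrite mobius_Some by now rewrite Cplus_comm.
  f_equal. f_equal; ring.
Qed.

Lemma disk_aut_opp (p : C) (x : Chat) :
  Cmod p < 1 -> disk_aut p (disk_aut (- p) x) = x.
Proof.
  intro Hp. pose proof (one_minus_conj_neq_0 p Hp) as N.
  unfold disk_aut. rewrite Copp_conj, mobius_comp.
  - rewrite <- (mobius_scalar (1 - Cconj p * p) x) at 2 by exact N. f_equal; ring.
  - intro H. apply N. rewrite <- H. ring.
Qed.

Lemma disk_aut_opp_inj (p : C) (x y : Chat) :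
  Cmod p < 1 -> disk_aut (- p) x = disk_aut (- p) y -> x = y.
Proof.
  intros Hp H. now rewrite <- (disk_aut_opp p x Hp), H, disk_aut_opp.
Qed.

Lemma disk_aut_opp_r (p : C) (x : Chat) :
  Cmod p < 1 -> disk_aut (- p) (disk_aut p x) = x.
Proof.
  intro Hp. replace p with (- - p)%C at 2 by ring.
  apply disk_aut_opp. now rewrite Cmod_opp.
Qed.

Lemma disk_aut_opp_center (p : C) :
  Cmod p < 1 -> disk_aut (- p) (Some p) = Some (RtoC 0).
Proof.
  intro Hp. rewrite disk_aut_Some; [|now rewrite Cmod_opp|exact Hp].
  f_equal. replace (p + - p)%C with (RtoC 0) by ring. apply Cmult_0_l.
Qed.

(** In the matrix product the upper row is [l] times that of [disk_aut (- p)]; the lower rows differ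
    by multiples of [s = conj(p) (1 - l) + c (1 - |p|^2)], assumed to be 0. *)
Lemma disk_aut_fixing (l c p : C) (x : Chat) :
  Cmod p < 1 -> l <> 0%C -> (Cconj p * (1 - l) + c * (1 - Cconj p * p) = 0)%C ->
  disk_aut (- p) (mobius (l + c * p) (p - l * p - c * p * p) c (1 - c * p) x)
  = dilation l (disk_aut (- p) x).
Proof.
  intros Hp Hl Hs. unfold disk_aut. rewrite Copp_conj, dilation_mobius, mobius_comp.
  - f_equal; try ring.
    + replace (- Cconj p * (l + c * p) + 1 * c)%C with
        (Cconj p * (1 - l) + c * (1 - Cconj p * p) - Cconj p)%C by ring.
      rewrite Hs; ring.
    + replace (- Cconj p * (p - l * p - c * p * p) + 1 * (1 - c * p))%C with
        (1 - p * (Cconj p * (1 - l) + c * (1 - Cconj p * p)))%C by ring.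
      rewrite Hs; ring.
  - replace ((l + c * p) * (1 - c * p) - (p - l * p - c * p * p) * c)%C with l by ring.
    exact Hl.
Qed.

Lemma rotation_elliptic (phi : Chat -> Chat) (l p : C) :
  linear_fractional phi -> ~ is_identity phi -> Cmod p < 1 -> Cmod l = 1 ->
  (forall x, disk_aut (- p) (phi x) = dilation l (disk_aut (- p) x)) ->
  elliptic phi.
Proof.
  intros Hphi Hid Hp Hl H. split; [exact Hphi|]. split; [exact Hid|]. split.
  (* The fixed points 0 and infinity of the rotation are pulled back to [p] and its reflection in
     the unit circle. *)
  - exists (Some p), (disk_aut p None). repeat split.
    + intro E. apply (f_equal (disk_aut (- p))) in E.
      rewrite disk_aut_opp_center, disk_aut_opp_r in E by exact Hp. discriminate.
    + apply (disk_aut_opp_inj p); [exact Hp|].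
      rewrite H, disk_aut_opp_center by exact Hp. simpl. f_equal. ring.
    + apply (disk_aut_opp_inj p); [exact Hp|].
      now rewrite H, disk_aut_opp_r by exact Hp.
  - exists l. split; [exact Hl|]. exists (disk_aut (- p)). split; [|exact H].
    exists (RtoC 1), (- p)%C, (Cconj (- p)), (RtoC 1). split; [|reflexivity].
    intro E. apply (one_minus_conj_neq_0 p Hp). rewrite <- E, Copp_conj. ring.
Qed.

Lemma rotation_disk_automorphism (phi : Chat -> Chat) (l p : C) :
  maps_disk phi -> Cmod p < 1 -> Cmod l = 1 ->
  (forall x, disk_aut (- p) (phi x) = dilation l (disk_aut (- p) x)) ->
  disk_automorphism phi.
Proof.
  intros HD Hp Hl H. split; [exact HD|]. intro w.
  assert (Hl0 : l <> 0%C) by (apply Cmod_gt_0; lra).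
  assert (Hp' : Cmod (- p) < 1) by now rewrite Cmod_opp.
  destruct (disk_automorphism_lt (- p) w Hp' (disk_lt w)) as [_ Hu].
  pose proof (disk_aut_Some (- p) w Hp' (disk_lt w)) as Ew.
  set (u := ((w + - p) / (1 + Cconj (- p) * w))%C) in *.
  (* The preimage of [w] is found by undoing the rotation in the coordinate centred at [p]. *)
  assert (Hv : Cmod (u / l) < 1) by (rewrite Cmod_div, Hl by exact Hl0; lra).
  destruct (disk_automorphism_lt p (u / l) Hp Hv) as [_ Hz].
  pose proof (disk_aut_Some p (u / l) Hp Hv) as Ez.
  exists (exist (fun z : C => Cmod z < 1) _ Hz). split.
  - simpl disk_val. rewrite <- Ez. apply (disk_aut_opp_inj p); [exact Hp|].
    rewrite H, disk_aut_opp_r, Ew by exact Hp. simpl. f_equal. field. exact Hl0.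
  - intros z' Hz'. apply disk_eq. simpl disk_val. apply Some_inj. rewrite <- Ez.
    apply (disk_aut_opp_inj p); [exact Hp|]. rewrite disk_aut_opp_r by exact Hp.
    apply (f_equal (disk_aut (- p))) in Hz'. rewrite H, Ew in Hz'.
    destruct (disk_aut (- p) (Some (z' : C))) as [v|]; simpl in Hz'; [|discriminate].
    apply Some_inj in Hz'. f_equal. rewrite <- Hz'. field. exact Hl0.
Qed.

Theorem theorem2p3 (phi : Chat -> Chat) (hphi : linear_fractional phi)
    (hD : maps_disk phi) (hid : ~ is_identity phi)
    (hp : exists p : disk, phi (Some (p : C)) = Some (p : C)) :
  forall nu : R,
    recurrent nu (comp_op (disk_map phi hD)) <->
    elliptic phi /\ disk_automorphism phi.
Proof.
  intro nu. split.
  2: { intros [He _]. apply recurrent_of_near_id. intros eta Heta.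
       now apply elliptic_iter_near_id. }
  intro Hrec. destruct hp as [p Hp].
  destruct (mobius_fixing phi p hphi Hp) as (l & c & Hl & Hphi).
  assert (Heq : forall z : disk,
    ((disk_map phi hD z - p) * (1 + c * (z - p)) = l * (z - p))%C).
  { intro z. apply fixing_eq. rewrite <- Hphi. apply disk_map_spec. }
  pose proof (fixing_disk_bound l c p _ Hl Heq) as Hb.
  set (s := (Cconj p * (1 - l) + c * (1 - Cconj p * p))%C) in *.
  pose proof (Cmod_ge_0 s).
  (* By [|l| + |s| <= 1], either [|l| < 1], which excludes recurrence, or [|l| = 1] and [s = 0]. *)
  destruct (Rlt_le_dec (Cmod l) 1) as [Hl1|Hl1].
  { destruct (fixing_contraction l c p _ Hl1 Heq) as (k & rho & Hk & Hrho & Hcon).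
    destruct (contraction_not_recurrent nu _ p k rho Hk Hrho Hcon Hrec). }
  assert (Hl2 : Cmod l = 1) by lra.
  assert (Hs : s = 0%C) by (apply Cmod_eq_0; lra).
  assert (Hconj : forall x, disk_aut (- p) (phi x) = dilation l (disk_aut (- p) x)).
  { intro x. rewrite Hphi. apply disk_aut_fixing; [apply disk_lt|exact Hl|exact Hs]. }
  split.
  - exact (rotation_elliptic phi l p hphi hid (disk_lt p) Hl2 Hconj).
  - exact (rotation_disk_automorphism phi l p hD (disk_lt p) Hl2 Hconj).
Qed.
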